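(* Let $k$ be a field with a nonarchimedean absolute value $v:k\to\mathbb{R}_{\geq0}$, let $X=\operatorname{Spec}R$ be an affine $k$-scheme, and let $\iota:X\to T$ be a closed immersion of $k$-schemes into an affine toric variety $T=\operatorname{Spec}k[A]$. Let $\mathbf k=k^{\mathrm{mon}}$, let $\mathbf v:\mathbf k\to\mathbf T$ be the morphism of ordered blueprints given by $v$, let $B$ be the ordered blueprint associated with $\iota$, and let $\operatorname{Trop}_{\mathbf v}(B)=B\otimes_{\mathbf k}\mathbf T$. (All notions are defined in the context.) Then there is a canonical isomorphism of semirings $$\operatorname{Bend}^{GG}_{v,\iota}(R)\;\longrightarrow\;\big(\operatorname{Trop}_{\mathbf v}(B)\otimes_{\mathbb{F}_1}\mathbb{B}\big)^+,$$ namely the one sending the class of $ta$ to the class of $\iota^\sharp(a)\otimes t$ for $t\in\mathbb{R}_{\geq0}$ and $a\in A$.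
   Context: All rings, semirings and monoids are commutative; semirings have $0$ and $1$. Ordered blueprints. An ordered blueprint is a triple $B=(B^\bullet,B^+,\leq)$ where $B^+$ is a semiring (the ambient semiring), $B^\bullet\subset B^+$ is a multiplicatively closed subset containing $0,1$ that generates $B^+$ as a semiring, and $\leq$ is a partial order on $B^+$ that is additive and multiplicative ($x\leq y$ implies $x+z\leq y+z$ and $xz\leq yz$). The order is generated by a set of relations if it is the smallest additive and multiplicative partial order containing them. A morphism $B\to C$ is a multiplicative map $B^\bullet\to C^\bullet$ preserving $0$ and $1$ that extends (necessarily uniquely) to an order-preserving semiring homomorphism $B^+\to C^+$. The tensor product $C\otimes_BD$ is the pushout of $C\leftarrow B\to D$ in the category of ordered blueprints; concretely, one takes the semiring $C^+\otimes_{B^+}D^+$, the smallest additive and multiplicative preorder on it containing the images of the relations of $C$ and of $D$, and passes to the quotient identifying $x$ and $y$ whenever $x\leq y$ and $y\leq x$; its elements are the pure tensors $c\otimes d$ with $c\in C^\bullet,d\in D^\bullet$. $\mathbb{F}_1=(\{0,1\},\mathbb{N},=)$ with the trivial partial order; it is initial in the category of ordered blueprints. $\mathbb{B}=(\{0,1\},\{0,1\},=)$ where the semiring $\{0,1\}$ satisfies $1+1=1$. For a monoid with zero $M$ let $M^+$ be the semiring $\mathbb{N}[M]$ of finite formal sums of elements of $M$, modulo identifying $0\in M$ with the empty sum. For a ring $R$ with multiplicative monoid $R^\bullet$, $R^{\mathrm{mon}}=(R^\bullet,(R^\bullet)^+,\leq)$ with $\leq$ generated by the relations $c\leq a+b$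 for $a,b,c\in R$ with $c=a+b$ in $R$. The tropical hyperfield is the ordered blueprint $\mathbf T$ with $\mathbf T^\bullet=(\mathbb{R}_{\geq0},\cdot)$, $\mathbf T^+=\mathbb{N}[\mathbb{R}_{>0}]=(\mathbf T^\bullet)^+$ and $\leq$ generated by the relations $c\leq a+b$ for all $a,b,c\in\mathbb{R}_{\geq0}$ such that the maximum among $a,b,c$ occurs (at least) twice. A nonarchimedean absolute value is a map $v:k\to\mathbb{R}_{\geq0}$ with $v(0)=0$, $v(1)=1$, $v(ab)=v(a)v(b)$, $v(a+b)\leq\max\{v(a),v(b)\}$; viewed as a map $\mathbf k^\bullet\to\mathbf T^\bullet$, it is a morphism $\mathbf v:\mathbf k\to\mathbf T$. $T=\operatorname{Spec}k[A]$ is an affine toric variety: $A$ is a (multiplicative) monoid that is finitely generated, integral (embeds into a group $G$) and saturated (if $A^{\mathrm{gp}}$ is the subgroup of $G$ generated by $A$, $a\in A^{\mathrm{gp}}$ and $a^n\in A$ for some $n\geq1$, then $a\in A$). $\iota^\sharp:k[A]\to R$ is the surjection corresponding to $\iota$. The ordered blueprint $B$ associated with $\iota$: $B^\bullet=\{\iota^\sharp(ca)\mid c\in k,a\in A\}$ as a submonoid of $R$; $B^+=(B^\bullet)^+$; and $\leq$ is generated by all relations $\iota^\sharp(c_aa)\leq\sum_j\iota^\sharp(c_jb_j)$ (finite formal sums, with $c_a,c_j\in k$, $a,b_j\in A$) for which $\iota^\sharp(c_aa)=\sum_j\iota^\sharp(c_jb_j)$ in $R$. It is an ordered blue $\mathbf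 k$-algebra via $c\mapsto\iota^\sharp(c1)$. The tropical semifield $\overline{\mathbb{R}}$ is the set $\mathbb{R}_{\geq0}$ with the usual multiplication and addition $a+b=\max\{a,b\}$; $\overline{\mathbb{R}}[A]$ is the monoid semiring of finite $\overline{\mathbb{R}}$-linear combinations of elements of $A$. The Giansiracusa bend $\operatorname{Bend}^{GG}_{v,\iota}(R)$ is the quotient of $\overline{\mathbb{R}}[A]$ by the semiring congruence generated by the relations $$v(c_a)a+\sum_jv(c_j)b_j\;\sim\;\sum_jv(c_j)b_j$$ for all $c_a,c_j\in k$ and $a,b_j\in A$ (finite sums) with $\iota^\sharp(c_aa)=\sum_j\iota^\sharp(c_jb_j)$ in $R$. *)

(* Defs.v *)
From HB Require Import structures.
From mathcomp Require Import all_boot all_order all_algebra finmap.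
From mathcomp Require Import boolp classical_sets reals.

Set Implicit Arguments.
Unset Strict Implicit.
Unset Printing Implicit Defensive.

Import Order.TTheory GRing.Theory Num.Theory.
Local Open Scope ring_scope.

HB.mixin Record Monoid_isComMonoid M of Monoid M := {
  mulmC : commutative (@monoid.mul M)
}.
#[short(type="comMonoidType")]
HB.structure Definition ComMonoid := {M of Monoid_isComMonoid M & Monoid M}.

HB.mixin Record ComMonoid_hasAbsorbing M of ComMonoid M := {
  mzero : M;
  mul0m : left_zero mzero (@monoid.mul M)
}.
#[short(type="monoid0Type")]
HB.structure Definition Monoid0 :=
  {M of ComMonoid_hasAbsorbing M & ComMonoid M}.
Arguments mzero {_}.

Section MulMonoid.
Variable S : comPzSemiRingType.
Definition mulmon : Type := S.
HB.instance Definition _ := Choice.on mulmon.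
HB.instance Definition _ := isMonoid.Build mulmon
  (@mulrA S) (@mul1r S) (@mulr1 S).
HB.instance Definition _ := Monoid_isComMonoid.Build mulmon (@mulrC S).
HB.instance Definition _ := ComMonoid_hasAbsorbing.Build mulmon (@mul0r S).
End MulMonoid.

(* [msr S A] is S[A], as finitely supported functions A -> S; [msrU s a] is the
   monomial s a. *)
Section MonoidSemiring.
Variables (S : nmodType) (A : choiceType).

Record msr := Msr { msr_val : {fsfun A -> S with 0} }.
HB.instance Definition _ := [isNew for msr_val].
HB.instance Definition _ := [Choice of msr by <:].

Definition coef (f : msr) (a : A) : S := msr_val f a.
Definition msupp (f : msr) : {fset A} := finsupp (msr_val f).

Lemma msrP (f g : msr) : (forall a, coef f a = coef g a) -> f = g.
Proof.
by case: f g => [f] [g] h; congr Msr; apply/fsfunP.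
Qed.

Lemma coef_dflt f a : a \notin msupp f -> coef f a = 0.
Proof. exact: fsfun_dflt. Qed.

Definition msr0 : msr := Msr [fsfun].
Definition msrU (s : S) (a : A) : msr := Msr [fsfun x in [fset a]%fset => s].
Definition msrD (f g : msr) : msr :=
  Msr [fsfun x in (msupp f `|` msupp g)%fset => coef f x + coef g x].

Lemma coef0 a : coef msr0 a = 0.
Proof. by rewrite /coef fsfunE. Qed.

Lemma coefU s a b : coef (msrU s a) b = if b == a then s else 0.
Proof. by rewrite /coef fsfunE inE. Qed.

Lemma coefD f g a : coef (msrD f g) a = coef f a + coef g a.
Proof.
rewrite {1}/coef fsfunE in_fsetU; case: ifPn => //.
by rewrite negb_or => /andP[hf hg]; rewrite !coef_dflt // addr0.
Qed.

Fact msrDA : associative msrD.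
Proof. by move=> f g h; apply: msrP => a; rewrite !coefD addrA. Qed.
Fact msrDC : commutative msrD.
Proof. by move=> f g; apply: msrP => a; rewrite !coefD addrC. Qed.
Fact msr0D : left_id msr0 msrD.
Proof. by move=> f; apply: msrP => a; rewrite coefD coef0 add0r. Qed.
HB.instance Definition _ := GRing.isNmodule.Build msr msrDA msrDC msr0D.

Lemma msrUD s t a : msrU (s + t) a = msrU s a + msrU t a.
Proof.
by apply: msrP => b; rewrite coefD !coefU; case: ifP; rewrite ?addr0.
Qed.
Lemma msrU0 a : msrU 0 a = 0.
Proof. by apply: msrP => b; rewrite coef0 coefU if_same. Qed.

Section Ext.
Variables (N : nmodType) (phi : S -> A -> N).
Hypotheses (phi0 : forall a, phi 0 a = 0)
  (phiD : forall s t a, phi (s + t) a = phi s a + phi t a).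
Definition msr_ext (f : msr) : N := \sum_(a <- msupp f) phi (coef f a) a.

Lemma msr_ext_incl (f : msr) (X : {fset A}) : (msupp f `<=` X)%fset ->
  msr_ext f = \sum_(a <- X) phi (coef f a) a.
Proof.
by move=> fX; apply: big_fset_incl => // a _ af; rewrite coef_dflt.
Qed.

Lemma msr_extD f g : msr_ext (f + g) = msr_ext f + msr_ext g.
Proof.
pose X := (msupp f `|` msupp g `|` msupp (f + g)%R)%fset.
have Xf : (msupp f `<=` X)%fset by apply/fsubsetP => a; rewrite !inE => ->.
have Xg : (msupp g `<=` X)%fset.
  by apply/fsubsetP => a; rewrite !inE => ->; rewrite orbT.
have Xfg : (msupp (f + g)%R `<=` X)%fset.
  by apply/fsubsetP => a; rewrite !in_fsetU => ->; rewrite orbT.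
rewrite (msr_ext_incl Xf) (msr_ext_incl Xg) (msr_ext_incl Xfg) -big_split.
by apply: eq_bigr => a _; rewrite coefD phiD.
Qed.

Lemma msr_ext0 : msr_ext 0 = 0.
Proof. by rewrite /msr_ext big1 // => a _; rewrite coef0. Qed.

Lemma msr_extU s a : msr_ext (msrU s a) = phi s a.
Proof.
rewrite (@msr_ext_incl _ [fset a]%fset) ?big_seq_fset1 ?coefU ?eqxx //.
apply/fsubsetP => b; rewrite mem_finsupp -/(coef _ _) coefU inE.
by case: ifP => //; rewrite eqxx.
Qed.
End Ext.

Lemma msr_sumU f : f = \sum_(a <- msupp f) msrU (coef f a) a.
Proof.
apply: msrP => b.
have -> : coef (\sum_(a <- msupp f) msrU (coef f a) a) b
  = \sum_(a <- msupp f) coef (msrU (coef f a) a) b.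
  by apply: (big_morph (fun g => coef g b)) => [g h|]; rewrite ?coefD ?coef0.
under eq_bigr do rewrite coefU.
have [bf|bf] := boolP (b \in msupp f).
  rewrite (big_fsetD1 b) //= eqxx big1_fset ?addr0 // => a.
  by rewrite !inE eq_sym; case: eqP.
rewrite coef_dflt // big1_fset // => a af _; case: eqP => // ba.
by rewrite -ba in af; rewrite af in bf.
Qed.

Lemma msr_ind (P : msr -> Prop) : P 0 -> (forall f g, P f -> P g -> P (f + g)) ->
  (forall s a, P (msrU s a)) -> forall f, P f.
Proof. by move=> P0 PD PU f; rewrite (msr_sumU f); elim/big_ind: _. Qed.
End MonoidSemiring.

Arguments msrU {S A} s a.

Section MonoidSemiringMul.
Variables (S : comPzSemiRingType) (A : comMonoidType).
Local Notation SA := (msr S A).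

Definition msr1 : SA := msrU 1 1%g.
Definition msrM (f g : SA) : SA :=
  \sum_(a <- msupp f) \sum_(b <- msupp g) msrU (coef f a * coef g b) (a * b)%g.

Let inner (g : SA) (s : S) (a : A) : SA :=
  msr_ext (fun t b => msrU (s * t) (a * b)%g) g.

Let innerD g s t a : inner g (s + t) a = inner g s a + inner g t a.
Proof.
by rewrite /inner /msr_ext -big_split; apply: eq_bigr => b _; rewrite mulrDl msrUD.
Qed.
Let inner0 g a : inner g 0 a = 0.
Proof. by rewrite /inner /msr_ext big1 // => b _; rewrite mul0r msrU0. Qed.

Let msrME f g : msrM f g = msr_ext (inner g) f. Proof. by []. Qed.

Fact msrDM : left_distributive msrM +%R.
Proof. by move=> f g h; rewrite !msrME msr_extD. Qed.
Fact msr0M : left_zero 0 msrM.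
Proof. by move=> f; rewrite msrME msr_ext0. Qed.
Lemma msrMU s t a b : msrM (msrU s a) (msrU t b) = msrU (s * t) (a * b)%g.
Proof.
rewrite msrME msr_extU //; rewrite /inner msr_extU // => c.
by rewrite mulr0 msrU0.
Qed.
Fact msrMC : commutative msrM.
Proof.
move=> f g; rewrite /msrM exchange_big; apply: eq_bigr => b _ /=.
by apply: eq_bigr => a _; rewrite mulrC mulmC.
Qed.
Let msrMD f g h : msrM f (g + h) = msrM f g + msrM f h.
Proof. by rewrite !(msrMC f) msrDM. Qed.
Let msrM0 f : msrM f 0 = 0.
Proof. by rewrite msrMC msr0M. Qed.
Fact msr1M : left_id msr1 msrM.
Proof.
elim/msr_ind => [|f g hf hg|s a]; rewrite ?msrM0 ?msrMD ?hf ?hg //.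
by rewrite msrMU mul1r mul1g.
Qed.
Fact msrMA : associative msrM.
Proof.
move=> f g h; elim/msr_ind: f => [|f f' Hf Hf'|s a]; rewrite ?msr0M ?msrDM ?Hf ?Hf' //.
elim/msr_ind: g => [|g g' Hg Hg'|t b]; rewrite ?(msrM0, msr0M, msrDM, msrMD) ?Hg ?Hg' //.
elim/msr_ind: h => [|h h' Hh Hh'|u c]; rewrite ?(msrM0, msrMD) ?Hh ?Hh' //.
by rewrite !msrMU mulrA mulgA.
Qed.
HB.instance Definition _ := GRing.Nmodule_isComPzSemiRing.Build SA
  msrMA msrMC msr1M msrDM msr0M.

Lemma msrUM s t a b : msrU s a * msrU t b = msrU (s * t) (a * b)%g :> SA.
Proof. exact: msrMU. Qed.
End MonoidSemiringMul.

Section MonoidRing.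
Variables (S : comPzRingType) (A : comMonoidType).
Definition msrN (f : msr S A) : msr S A :=
  msr_ext (fun s a => msrU (- s) a) f.
Fact msrNf : left_inverse 0 msrN +%R.
Proof.
have ND : {morph msrN : f g / f + g}.
  by move=> f g; apply: msr_extD => [a|s t a]; rewrite ?oppr0 ?msrU0 ?opprD ?msrUD.
elim/msr_ind => [|f g hf hg|s a].
- by rewrite addr0 /msrN msr_ext0 // => a; rewrite oppr0 msrU0.
- by rewrite ND addrACA hf hg addr0.
by rewrite /msrN msr_extU => [|b]; rewrite ?oppr0 ?msrU0 // -msrUD addNr msrU0.
Qed.
HB.instance Definition _ := GRing.Nmodule_isZmodule.Build (msr S A) msrNf.
End MonoidRing.

Section MonoidSemiringMorph.
Variables (S S' : comPzSemiRingType) (A : comMonoidType).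
Variables (sigma : {rmorphism S -> S'}) (phi : A -> S').
Hypotheses (phi1 : phi 1%g = 1) (phiM : {morph phi : a b / (a * b)%g >-> a * b}).

Definition msr_morph (f : msr S A) : S' :=
  \sum_(a <- msupp f) sigma (coef f a) * phi a.

Let phi_ext0 a : sigma 0 * phi a = 0. Proof. by rewrite rmorph0 mul0r. Qed.
Let phi_extD s t a : sigma (s + t) * phi a = sigma s * phi a + sigma t * phi a.
Proof. by rewrite rmorphD mulrDl. Qed.

Lemma msr_morphU s a : msr_morph (msrU s a) = sigma s * phi a.
Proof. exact: (msr_extU (phi := fun s a => sigma s * phi a)). Qed.
Lemma msr_morph_is_nmod : nmod_morphism msr_morph.
Proof.
split=> [|f g].
  exact: (msr_ext0 (phi := fun s a => sigma s * phi a)).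
exact: (msr_extD (phi := fun s a => sigma s * phi a)).
Qed.
Let mm0 := msr_morph_is_nmod.1.
Let mmD := msr_morph_is_nmod.2.
Lemma msr_morph_is_monoid : monoid_morphism msr_morph.
Proof.
split=> [|f g]; first by rewrite msr_morphU rmorph1 phi1 mulr1.
elim/msr_ind: f => [|f f' hf hf'|s a].
- by rewrite mul0r mm0 mul0r.
- by rewrite mulrDl !mmD hf hf' mulrDl.
elim/msr_ind: g => [|g g' hg hg'|t b].
- by rewrite mulr0 mm0 mulr0.
- by rewrite mulrDr !mmD hg hg' mulrDr.
by rewrite msrUM !msr_morphU rmorphM phiM mulrACA.
Qed.
End MonoidSemiringMorph.

Record semicong (S : comPzSemiRingType) := SemiCong {
  srel :> S -> S -> Prop;
  srel_refl : forall x, srel x x;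
  srel_sym : forall x y, srel x y -> srel y x;
  srel_trans : forall y x z, srel x y -> srel y z -> srel x z;
  srelD : forall z x y, srel x y -> srel (x + z) (y + z);
  srelM : forall z x y, srel x y -> srel (x * z) (y * z)
}.

(* [quot E] is the semiring S / E, and [cls E x] the class of x. *)
Section Quotient.
Variables (S : comPzSemiRingType) (E : semicong S).

Let e : rel S := fun x y => `[< E x y >].
Fact srel_is_refl : reflexive e.
Proof. by move=> x; apply/asboolP; exact: srel_refl. Qed.
Fact srel_is_sym : symmetric e.
Proof. by move=> x y; apply/asboolP/asboolP; exact: srel_sym. Qed.
Fact srel_is_trans : transitive e.
Proof.
by move=> y x z /asboolP xy /asboolP yz; apply/asboolP; exact: srel_trans xy yz.
Qed.
Definition srel_equiv : equiv_rel S :=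
  EquivRel e srel_is_refl srel_is_sym srel_is_trans.

Definition quot : Type := {eq_quot srel_equiv}%qT.
HB.instance Definition _ := Choice.on quot.
HB.instance Definition _ := EqQuotient.on quot.

Definition cls (x : S) : quot := (\pi_quot x)%qT.

Lemma clsP x y : cls x = cls y <-> E x y.
Proof.
by split=> [/eqquotP /asboolP|xy]; [|apply/eqquotP/asboolP].
Qed.
Lemma cls_repr (x : quot) : cls (repr x) = x.
Proof. exact: reprK. Qed.
Lemma repr_cls x : E (repr (cls x)) x.
Proof. by apply/clsP; rewrite cls_repr. Qed.
Lemma quot_ind (P : quot -> Prop) : (forall x, P (cls x)) -> forall x, P x.
Proof. by move=> h x; rewrite -(cls_repr x). Qed.

Definition quotD (x y : quot) : quot := cls (repr x + repr y).
Definition quotM (x y : quot) : quot := cls (repr x * repr y).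

Lemma srelDD x x' y y' : E x x' -> E y y' -> E (x + y) (x' + y').
Proof.
move=> xx yy; apply: (srel_trans (srelD y xx)).
by rewrite !(addrC x'); apply: srelD.
Qed.
Lemma srelMM x x' y y' : E x x' -> E y y' -> E (x * y) (x' * y').
Proof.
move=> xx yy; apply: (srel_trans (srelM y xx)).
by rewrite !(mulrC x'); apply: srelM.
Qed.

Lemma quotDE x y : quotD (cls x) (cls y) = cls (x + y).
Proof. by apply/clsP; apply: srelDD; exact: repr_cls. Qed.
Lemma quotME x y : quotM (cls x) (cls y) = cls (x * y).
Proof. by apply/clsP; apply: srelMM; exact: repr_cls. Qed.

Fact quotDA : associative quotD.
Proof.
by elim/quot_ind => x; elim/quot_ind => y; elim/quot_ind => z; rewrite !quotDE addrA.
Qed.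
Fact quotDC : commutative quotD.
Proof. by elim/quot_ind => x; elim/quot_ind => y; rewrite !quotDE addrC. Qed.
Fact quot0D : left_id (cls 0) quotD.
Proof. by elim/quot_ind => x; rewrite !quotDE add0r. Qed.
HB.instance Definition _ := GRing.isNmodule.Build quot quotDA quotDC quot0D.

Fact quotMA : associative quotM.
Proof.
by elim/quot_ind => x; elim/quot_ind => y; elim/quot_ind => z; rewrite !quotME mulrA.
Qed.
Fact quotMC : commutative quotM.
Proof. by elim/quot_ind => x; elim/quot_ind => y; rewrite !quotME mulrC. Qed.
Fact quot1M : left_id (cls 1) quotM.
Proof. by elim/quot_ind => x; rewrite !quotME mul1r. Qed.
Fact quotDM : left_distributive quotM quotD.
Proof.
elim/quot_ind => x; elim/quot_ind => y; elim/quot_ind => z.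
by rewrite quotDE !quotME quotDE mulrDl.
Qed.
Fact quot0M : left_zero (cls 0) quotM.
Proof. by elim/quot_ind => x; rewrite !quotME mul0r. Qed.
HB.instance Definition _ := GRing.Nmodule_isComPzSemiRing.Build quot
  quotMA quotMC quot1M quotDM quot0M.

Fact cls_is_nmod : nmod_morphism cls.
Proof. by split=> // x y; rewrite -quotDE. Qed.
Fact cls_is_monoid : monoid_morphism cls.
Proof. by split=> // x y; rewrite -quotME. Qed.
HB.instance Definition _ := GRing.isNmodMorphism.Build S quot cls cls_is_nmod.
HB.instance Definition _ := GRing.isMonoidMorphism.Build S quot cls cls_is_monoid.

Section Lift.
Variables (S' : comPzSemiRingType) (f : {rmorphism S -> S'}).
Hypothesis fE : forall x y, E x y -> f x = f y.
Definition quot_lift (x : quot) : S' := f (repr x).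
Lemma quot_liftE x : quot_lift (cls x) = f x.
Proof. by apply: fE; exact: repr_cls. Qed.
Lemma quot_lift_is_nmod : nmod_morphism quot_lift.
Proof.
split; first by rewrite quot_liftE rmorph0.
elim/quot_ind => x; elim/quot_ind => y.
by rewrite -rmorphD !quot_liftE rmorphD.
Qed.
Lemma quot_lift_is_monoid : monoid_morphism quot_lift.
Proof.
split; first by rewrite quot_liftE rmorph1.
elim/quot_ind => x; elim/quot_ind => y.
by rewrite -rmorphM !quot_liftE rmorphM.
Qed.
End Lift.
End Quotient.

Section Generated.
Variables (S : comPzSemiRingType) (r : S -> S -> Prop).

Inductive gen_eq : S -> S -> Prop :=
| gen_eq_base x y : r x y -> gen_eq x y
| gen_eq_refl x : gen_eq x x
| gen_eq_sym x y : gen_eq x y -> gen_eq y x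
| gen_eq_trans y x z : gen_eq x y -> gen_eq y z -> gen_eq x z
| gen_eqD z x y : gen_eq x y -> gen_eq (x + z) (y + z)
| gen_eqM z x y : gen_eq x y -> gen_eq (x * z) (y * z).

Definition gen_cong : semicong S :=
  SemiCong gen_eq_refl gen_eq_sym gen_eq_trans gen_eqD gen_eqM.

Inductive gen_le : S -> S -> Prop :=
| gen_le_base x y : r x y -> gen_le x y
| gen_le_refl x : gen_le x x
| gen_le_trans y x z : gen_le x y -> gen_le y z -> gen_le x z
| gen_leD z x y : gen_le x y -> gen_le (x + z) (y + z)
| gen_leM z x y : gen_le x y -> gen_le (x * z) (y * z).

(* Antisymmetrization of the generated preorder. *)
Definition gen_le_cong : semicong S.
Proof.
apply: (@SemiCong S (fun x y => gen_le x y /\ gen_le y x)).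
- by split; exact: gen_le_refl.
- by move=> x y [].
- by move=> y x z [xy yx] [yz zy]; split; apply: gen_le_trans; eassumption.
- by move=> z x y [xy yx]; split; apply: gen_leD.
- by move=> z x y [xy yx]; split; apply: gen_leM.
Defined.

Lemma gen_eq_morph (S' : comPzSemiRingType) (f : {rmorphism S -> S'}) :
  (forall x y, r x y -> f x = f y) -> forall x y, gen_eq x y -> f x = f y.
Proof.
move=> fr x y; elim=> {x y} //.
- by move=> y x z _ -> _ ->.
- by move=> z x y _ xy; rewrite !rmorphD xy.
- by move=> z x y _ xy; rewrite !rmorphM xy.
Qed.
End Generated.

Record ordBlueprint := OrdBlueprint {
  amb :> comPzSemiRingType;
  dot : set amb;
  ble : amb -> amb -> Prop;
  dot0 : dot 0;
  dot1 : dot 1;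
  dotM : forall x y, dot x -> dot y -> dot (x * y);
  dot_gen : forall P : set amb, P 0 -> P 1 ->
    (forall x y, P x -> P y -> P (x + y)) ->
    (forall x y, P x -> P y -> P (x * y)) ->
    (forall x, dot x -> P x) -> forall x, P x;
  ble_refl : forall x, ble x x;
  ble_anti : forall x y, ble x y -> ble y x -> x = y;
  ble_trans : forall y x z, ble x y -> ble y z -> ble x z;
  bleD : forall z x y, ble x y -> ble (x + z) (y + z);
  bleM : forall z x y, ble x y -> ble (x * z) (y * z)
}.

(* A morphism is given by its extension to the ambient semirings, which is
   determined by the underlying map of monoids ([bpMorph_ext]). *)
Record bpMorph (B C : ordBlueprint) := BpMorph {
  bpm :> {rmorphism B -> C};
  bpm_dot : forall x, dot x -> dot (bpm x);
  bpm_le : forall x y, ble x y -> ble (bpm x) (bpm y)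
}.

Lemma bpMorph_ext (B C : ordBlueprint) (f g : bpMorph B C) :
  (forall x, dot x -> f x = g x) -> f =1 g.
Proof.
move=> fg; apply: dot_gen => //; rewrite ?rmorph0 ?rmorph1 //.
- by move=> x y hx hy; rewrite !rmorphD hx hy.
- by move=> x y hx hy; rewrite !rmorphM hx hy.
Qed.

(* [plus M] is M^+ and [emb] the inclusion of M. *)
Section Plus.
Variable M : monoid0Type.

Definition plus : Type :=
  quot (gen_cong (fun x y : msr nat M => x = msrU 1%N mzero /\ y = 0)).
HB.instance Definition _ := GRing.ComPzSemiRing.on plus.

Definition emb (m : M) : plus := cls _ (msrU 1%N m).

Lemma emb0 : emb mzero = 0.
Proof. by apply/clsP; apply: gen_eq_base. Qed.
Lemma emb1 : emb 1%g = 1. Proof. by []. Qed.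
Lemma embM m n : emb (m * n)%g = emb m * emb n.
Proof. by rewrite /emb -rmorphM msrUM. Qed.

Lemma plus_ind (P : plus -> Prop) : P 0 -> (forall x y, P x -> P y -> P (x + y)) ->
  (forall m, P (emb m)) -> forall x, P x.
Proof.
move=> P0 PD Pm; elim/quot_ind; elim/msr_ind => [|f g hf hg|n m].
- exact: P0.
- by have := PD _ _ hf hg; rewrite -rmorphD.
elim: n => [|n IHn]; first by rewrite msrU0; exact: P0.
by have := PD _ _ (Pm m) IHn; rewrite -rmorphD /= -msrUD.
Qed.

Section PlusMorph.
Variables (S : comPzSemiRingType) (phi : M -> S).
Hypotheses (phi0 : phi mzero = 0) (phi1 : phi 1%g = 1)
  (phiM : {morph phi : a b / (a * b)%g >-> a * b}).
Let f := msr_morph (GRing.natmul (1 : S)) phi.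
Let fn : nmod_morphism f := msr_morph_is_nmod _ _.
Let fm : monoid_morphism f := msr_morph_is_monoid _ phi1 phiM.
HB.instance Definition _ := GRing.isNmodMorphism.Build _ _ f fn.
HB.instance Definition _ := GRing.isMonoidMorphism.Build _ _ f fm.
Let fE x y : gen_cong (fun x y : msr nat M => x = msrU 1%N mzero /\ y = 0) x y ->
  f x = f y.
Proof.
apply: (gen_eq_morph (f := f)) => {}x {}y [-> ->].
rewrite rmorph0; apply: etrans (msr_morphU _ _ _ _) _.
by rewrite phi0 mulr0.
Qed.
Definition plus_morph_fun (x : plus) : S := quot_lift f x.
Fact plus_morph_is_nmod : nmod_morphism plus_morph_fun.
Proof. exact: quot_lift_is_nmod. Qed.
Fact plus_morph_is_monoid : monoid_morphism plus_morph_fun.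
Proof. exact: quot_lift_is_monoid. Qed.
HB.instance Definition _ := GRing.isNmodMorphism.Build _ _ plus_morph_fun plus_morph_is_nmod.
HB.instance Definition _ := GRing.isMonoidMorphism.Build _ _ plus_morph_fun plus_morph_is_monoid.
Definition plus_morph : {rmorphism plus -> S} := plus_morph_fun.
Lemma plus_morphE m : plus_morph (emb m) = phi m.
Proof. by rewrite /plus_morph /= /plus_morph_fun quot_liftE //; apply: etrans (msr_morphU _ _ _ _) _; rewrite mul1r. Qed.
End PlusMorph.
End Plus.

(* [free_bp] is (M, M^+, <=) with <= generated by r. The hypothesis on r, in terms
   of the number [len] of nonzero terms of a formal sum, makes the preorder
   [gen_le r] antisymmetric, so that it is the smallest additive and
   multiplicative partial order containing r. *)
Section FreeBlueprint.
Variable M : monoid0Type.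

Let plen (f : msr nat M) : nat :=
  msr_ext (fun n m => if m == mzero then 0 else n)%N f.
Let plenU n m : plen (msrU n m) = (if m == mzero then 0 else n)%N.
Proof. by rewrite /plen msr_extU // => a; rewrite if_same. Qed.
Let plenD f g : plen (f + g) = (plen f + plen g)%N.
Proof.
by apply: msr_extD => [a|s t a]; rewrite ?if_same //; case: ifP.
Qed.
Let plen0 : plen 0 = 0%N.
Proof. by apply: msr_ext0 => a; rewrite if_same. Qed.

Let plen_cong (x y : msr nat M) :
  gen_eq (fun x y : msr nat M => x = msrU 1%N mzero /\ y = 0) x y ->
  forall z, plen (x * z) = plen (y * z).
Proof.
elim=> {x y} [x y [-> ->]|x|x y _ h|y x w _ h _ h'|w x y _ h|w x y _ h] z //.
- rewrite mul0r plen0; elim/msr_ind: z => [|f g hf hg|n m].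
  + by rewrite mulr0 plen0.
  + by rewrite mulrDr plenD hf hg.
  by rewrite msrUM plenU mul0m eqxx.
- by rewrite h h'.
- by rewrite !mulrDl !plenD h.
- by rewrite -!mulrA h.
Qed.

Definition len (x : plus M) : nat := plen (repr x).
Arguments len x%_ring_scope.
Let lenE x : len (cls _ x) = plen x.
Proof.
have := plen_cong (@repr_cls _ (gen_cong _) x) 1.
by rewrite !mulr1.
Qed.
Lemma len0 : len 0 = 0%N.
Proof. by rewrite lenE plen0. Qed.
Lemma lenD x y : len (x + y) = (len x + len y)%N.
Proof.
elim/quot_ind: x => x; elim/quot_ind: y => y.
by rewrite -rmorphD !lenE plenD.
Qed.
Lemma len_emb m : len (emb m) = (m != mzero).
Proof. by rewrite lenE plenU; case: eqP. Qed.

Variable r : plus M -> plus M -> Prop.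
Hypothesis hr : forall x y, r x y -> forall m,
  x * emb m = y * emb m \/ (len (x * emb m) < len (y * emb m))%N.

Let eqlt (x y : plus M) := x = y \/ (len x < len y)%N.

Let eqltD x y x' y' : eqlt x y -> eqlt x' y' -> eqlt (x + x') (y + y').
Proof.
rewrite /eqlt !lenD => -[->|h] [->|h']; first by left.
- by right; rewrite ltn_add2l.
- by right; rewrite ltn_add2r.
- by right; rewrite -addSn leq_add // ltnW.
Qed.

Let gen_le_eqlt x y : gen_le r x y -> forall z, eqlt (x * z) (y * z).
Proof.
elim=> {x y} [x y rxy|x|y x w _ h _ h'|w x y _ h|w x y _ h] z.
- elim/plus_ind: z => [|z z' h h'|m]; [|by rewrite !mulrDr; apply: eqltD|exact: hr].
  by rewrite !mulr0; left.
- by left.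
- case: (h z) (h' z) => [->//|xy] [<-|yz]; first by right.
  by right; apply: ltn_trans yz.
- by rewrite !mulrDl; apply: eqltD => //; left.
- by rewrite -!mulrA.
Qed.

Fact gen_le_anti x y : gen_le r x y -> gen_le r y x -> x = y.
Proof.
move=> /gen_le_eqlt h /gen_le_eqlt h'; have := h' 1; have := h 1.
by rewrite !mulr1 => -[//|xy] [//|yx]; have := ltn_trans xy yx; rewrite ltnn.
Qed.

Let fdot : set (plus M) := range (@emb M).
Let fdot0 : fdot 0. Proof. by exists mzero => //; exact: emb0. Qed.
Let fdot1 : fdot 1. Proof. by exists 1%g. Qed.
Let fdotM x y : fdot x -> fdot y -> fdot (x * y).
Proof. by move=> [m _ <-] [n _ <-]; exists (m * n)%g => //; exact: embM. Qed.
Let fdot_gen (P : set (plus M)) : P 0 -> P 1 ->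
    (forall x y, P x -> P y -> P (x + y)) ->
    (forall x y, P x -> P y -> P (x * y)) ->
    (forall x, fdot x -> P x) -> forall x, P x.
Proof. by move=> P0 _ PD _ Pd; apply: plus_ind => // m; apply: Pd; exists m. Qed.

Definition free_bp : ordBlueprint :=
  @OrdBlueprint (plus M) fdot (gen_le r) fdot0 fdot1 fdotM fdot_gen
    (@gen_le_refl _ r) gen_le_anti (@gen_le_trans _ r) (@gen_leD _ r) (@gen_leM _ r).

Section FreeMorph.
Variables (C : ordBlueprint) (phi : M -> C).
Hypotheses (phi0 : phi mzero = 0) (phi1 : phi 1%g = 1)
  (phiM : {morph phi : a b / (a * b)%g >-> a * b}).
Hypothesis phi_dot : forall m, dot (phi m).
Hypothesis phi_le : forall x y, r x y ->
  ble (plus_morph phi0 phi1 phiM x) (plus_morph phi0 phi1 phiM y).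
Let f : {rmorphism free_bp -> C} := plus_morph phi0 phi1 phiM.
Let f_dot x : dot x -> dot (f x).
Proof. by move=> [m _ <-]; rewrite /f plus_morphE. Qed.
Let f_le x y : ble x y -> ble (f x) (f y).
Proof.
elim=> {x y} [x y /phi_le//|x|y x z _ h _ h'|z x y _ h|z x y _ h].
- exact: ble_refl.
- exact: ble_trans h h'.
- by rewrite !rmorphD; apply: bleD.
- by rewrite !rmorphM; apply: bleM.
Qed.
Definition free_morph : bpMorph free_bp C := BpMorph f_dot f_le.
End FreeMorph.
End FreeBlueprint.
Arguments len {M} x%_ring_scope.

Section Mon.
Variable R : comPzRingType.
Definition mon_rel (x y : plus (mulmon R)) : Prop :=
  exists a b c : R, [/\ c = a + b, x = emb (c : mulmon R)
    & y = emb (a : mulmon R) + emb (b : mulmon R)].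
Fact mon_relP x y : mon_rel x y -> forall m,
  x * emb m = y * emb m \/ (len (x * emb m) < len (y * emb m))%N.
Proof.
move=> [a [b [c [-> -> ->]]]] m; rewrite mulrDl -!embM lenD !len_emb.
have E : ((a + b : R) : mulmon R) * m = (a * m : R) + (b * m : R) :> R.
  exact: mulrDl.
have [am|am] := eqVneq ((a : mulmon R) * m)%g mzero.
  rewrite am emb0 add0r; left; congr emb; apply: etrans E _.
  by rewrite [a * m]am add0r.
have [bm|bm] := eqVneq ((b : mulmon R) * m)%g mzero.
  rewrite bm emb0 addr0; left; congr emb; apply: etrans E _.
  by rewrite [b * m]bm addr0.
by right; case: (_ != _).
Qed.
Definition mon : ordBlueprint := free_bp mon_relP.
End Mon.

Section Tropical.
Variable R : realType.
(* The tropical semifield: nonnegative reals with max and *. Its multiplicative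
   monoid also serves as the underlying monoid of the tropical hyperfield [bpT]. *)
Record tropR := TropR { tval :> R; tval_ge0 : 0 <= tval }.
HB.instance Definition _ := [isSub for tval].
HB.instance Definition _ := [Choice of tropR by <:].

Fact tmax_ge0 (a b : tropR) : 0 <= Num.max (a : R) (b : R).
Proof. by rewrite le_max tval_ge0. Qed.
Fact tmul_ge0 (a b : tropR) : 0 <= (a : R) * (b : R).
Proof. by rewrite mulr_ge0 ?tval_ge0. Qed.
Definition tadd (a b : tropR) := TropR (tmax_ge0 a b).
Definition tmul (a b : tropR) := TropR (tmul_ge0 a b).
Definition tzero := TropR (lexx (0 : R)).
Definition tone := TropR (@ler01 R).

Fact taddA : associative tadd.
Proof. by move=> a b c; apply: val_inj; rewrite /= maxA. Qed.
Fact taddC : commutative tadd.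
Proof. by move=> a b; apply: val_inj; rewrite /= maxC. Qed.
Fact tadd0 : left_id tzero tadd.
Proof. by move=> a; apply: val_inj; apply/max_idPr; exact: tval_ge0. Qed.
HB.instance Definition _ := GRing.isNmodule.Build tropR taddA taddC tadd0.
Fact tmulA : associative tmul.
Proof. by move=> a b c; apply: val_inj; rewrite /= mulrA. Qed.
Fact tmulC : commutative tmul.
Proof. by move=> a b; apply: val_inj; rewrite /= mulrC. Qed.
Fact tmul1 : left_id tone tmul.
Proof. by move=> a; apply: val_inj; rewrite /= mul1r. Qed.
Fact tmulD : left_distributive tmul tadd.
Proof. by move=> a b c; apply: val_inj; rewrite /= maxr_pMl ?tval_ge0. Qed.
Fact tmul0 : left_zero tzero tmul.
Proof. by move=> a; apply: val_inj; rewrite /= mul0r. Qed.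
HB.instance Definition _ := GRing.Nmodule_isComPzSemiRing.Build tropR
  tmulA tmulC tmul1 tmulD tmul0.

Definition max_twice (a b c : R) : Prop :=
  [\/ a = b /\ c <= a, a = c /\ b <= a | b = c /\ a <= b].

Definition trop_rel (x y : plus (mulmon tropR)) : Prop :=
  exists a b c : tropR, [/\ max_twice a b c, x = emb (c : mulmon tropR)
    & y = emb (a : mulmon tropR) + emb (b : mulmon tropR)].

Fact trop_relP x y : trop_rel x y -> forall m,
  x * emb m = y * emb m \/ (len (x * emb m) < len (y * emb m))%N.
Proof.
move=> [a [b [c [abc -> ->]]]] m; rewrite mulrDl -!embM lenD !len_emb.
pose n : R := tval m.
have {}abc : max_twice ((a : R) * n) ((b : R) * n) ((c : R) * n).
  have m0 : 0 <= n := tval_ge0 m.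
  by case: abc => -[-> h]; [apply: Or31|apply: Or32|apply: Or33]; split=> //;
    apply: ler_wpM2r.
have c0 : 0 <= (c : R) * n := tmul_ge0 c m.
have b0 : 0 <= (b : R) * n := tmul_ge0 b m.
have a0 : 0 <= (a : R) * n := tmul_ge0 a m.
have [am|am] := eqVneq ((a : mulmon tropR) * m)%g mzero.
  rewrite am emb0 add0r; left; congr emb; apply: val_inj => /=; rewrite -/n.
  have {am} : (a : R) * n = 0 by have /(congr1 val) := am.
  move=> am; rewrite am in abc.
  case: abc => [[<- h]|[h h']|[-> //]]; first by apply: le_anti; rewrite h c0.
  by rewrite -h; apply: le_anti; rewrite h' b0.
have [bm|bm] := eqVneq ((b : mulmon tropR) * m)%g mzero.
  rewrite bm emb0 addr0; left; congr emb; apply: val_inj => /=; rewrite -/n.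
  have {bm} : (b : R) * n = 0 by have /(congr1 val) := bm.
  move=> bm; rewrite bm in abc.
  case: abc => [[-> h]|[-> //]|[h h']]; first by apply: le_anti; rewrite h c0.
  by rewrite -h; apply: le_anti; rewrite h' a0.
by right; case: (_ != _).
Qed.

Definition bpT : ordBlueprint := free_bp trop_relP.
End Tropical.

Section Base.
Definition F1_dot : set nat := fun n => n = 0%N \/ n = 1%N.
Fact F1_dotM (x y : nat) : F1_dot x -> F1_dot y -> F1_dot (x * y).
Proof. by move=> [->|->] [->|->]; [left|left|left|right]. Qed.
Fact F1_gen (P : set nat) : P 0 -> P 1 ->
    (forall x y : nat, P x -> P y -> P (x + y)) ->
    (forall x y : nat, P x -> P y -> P (x * y)) ->
    (forall x, F1_dot x -> P x) -> forall x, P x.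
Proof.
by move=> P0 P1 PD _ _; elim=> // n Pn; rewrite -add1n; exact: (PD 1%N n).
Qed.
Fact eq_leD (S : comPzSemiRingType) (z x y : S) : x = y -> x + z = y + z.
Proof. by move=> ->. Qed.
Fact eq_leM (S : comPzSemiRingType) (z x y : S) : x = y -> x * z = y * z.
Proof. by move=> ->. Qed.
Definition F1 : ordBlueprint :=
  @OrdBlueprint nat F1_dot eq (or_introl erefl) (or_intror erefl) F1_dotM F1_gen
    (@erefl nat) (fun _ _ h _ => h) (fun _ _ _ => @etrans _ _ _ _)
    (@eq_leD nat) (@eq_leM nat).

(* [bool] already carries the ring structure of the field with two elements *)
Definition bool2 : Type := bool.
HB.instance Definition _ := Choice.on bool2.
HB.instance Definition _ := GRing.isNmodule.Build bool2 orbA orbC orFb.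
HB.instance Definition _ := GRing.Nmodule_isComPzSemiRing.Build bool2
  andbA andbC andTb andb_orl andFb.

(* [BB] is the ordered blueprint B = ({0,1}, {0,1}, =) with 1 + 1 = 1. *)
Definition BB_dot : set bool2 := fun _ => True.
Definition BB : ordBlueprint :=
  @OrdBlueprint bool2 BB_dot eq I I (fun _ _ _ _ => I)
    (fun _ _ _ _ _ h x => h x I)
    (@erefl bool2) (fun _ _ h _ => h) (fun _ _ _ => @etrans _ _ _ _)
    (@eq_leD bool2) (@eq_leM bool2).

Variable C : ordBlueprint.
Let f : {rmorphism F1 -> C} := GRing.natmul (1 : C).
Let f_dot x : dot x -> dot (f x).
Proof. by move=> [->|->]; rewrite ?rmorph0 ?rmorph1; [exact: dot0|exact: dot1]. Qed.
Let f_le x y : ble x y -> ble (f x) (f y).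
Proof. by move=> ->; exact: ble_refl. Qed.
Definition F1_init : bpMorph F1 C := BpMorph f_dot f_le.
End Base.

(* [tens_sr] is the semiring tensor product C^+ (x)_{B^+} D^+, presented as
   N[C^+ x D^+] modulo bilinearity and balancing; [tens_amb] is its quotient by
   the antisymmetrized preorder. [tens_pushout] is the universal property. *)
Section Tensor.
Variables (B C D : ordBlueprint) (f : bpMorph B C) (g : bpMorph B D).

Let T0 := msr nat (mulmon (C * D)%type).
Let u (c : C) (d : D) : T0 := msrU 1%N ((c, d) : mulmon (C * D)%type).

Inductive tens_rel : T0 -> T0 -> Prop :=
| tens_addl c c' d : tens_rel (u (c + c') d) (u c d + u c' d)
| tens_addr c d d' : tens_rel (u c (d + d')) (u c d + u c d')
| tens_0l d : tens_rel (u 0 d) 0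
| tens_0r c : tens_rel (u c 0) 0
| tens_bal b c d : tens_rel (u (c * f b) d) (u c (g b * d)).

Definition tens_sr : Type := quot (gen_cong tens_rel).
HB.instance Definition _ := GRing.ComPzSemiRing.on tens_sr.
Definition pure_sr (c : C) (d : D) : tens_sr := cls _ (u c d).

Inductive tens_ler : tens_sr -> tens_sr -> Prop :=
| tens_lel c c' : ble c c' -> tens_ler (pure_sr c 1) (pure_sr c' 1)
| tens_lerr d d' : ble d d' -> tens_ler (pure_sr 1 d) (pure_sr 1 d').

Definition tens_amb : Type := quot (gen_le_cong tens_ler).
HB.instance Definition _ := GRing.ComPzSemiRing.on tens_amb.
Definition pure (c : C) (d : D) : tens_amb := cls _ (pure_sr c d).

Definition tens_le (x y : tens_amb) : Prop := gen_le tens_ler (repr x) (repr y).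

Definition tens_dot : set tens_amb :=
  fun x => exists c d, [/\ dot c, dot d & x = pure c d].

Lemma pureM c d c' d' : pure c d * pure c' d' = pure (c * c') (d * d').
Proof. by rewrite /pure -rmorphM /pure_sr -rmorphM /u msrUM. Qed.
Lemma pureDl c c' d : pure (c + c') d = pure c d + pure c' d.
Proof.
rewrite /pure -rmorphD; congr cls; rewrite /pure_sr -rmorphD; apply/clsP.
exact/gen_eq_base/tens_addl.
Qed.
Lemma pureDr c d d' : pure c (d + d') = pure c d + pure c d'.
Proof.
rewrite /pure -rmorphD; congr cls; rewrite /pure_sr -rmorphD; apply/clsP.
exact/gen_eq_base/tens_addr.
Qed.
Lemma pure0l d : pure 0 d = 0.
Proof.
by congr cls; apply/clsP; exact/gen_eq_base/tens_0l.
Qed.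
Lemma pure0r c : pure c 0 = 0.
Proof.
by congr cls; apply/clsP; exact/gen_eq_base/tens_0r.
Qed.
Lemma pure11 : pure 1 1 = 1. Proof. by []. Qed.
Lemma pure_bal b : pure (f b) 1 = pure 1 (g b).
Proof.
congr cls; apply/clsP.
have := gen_eq_base (tens_bal b 1 1).
by rewrite mul1r mulr1.
Qed.

Lemma tens_ind (P : tens_amb -> Prop) : P 0 ->
  (forall x y, P x -> P y -> P (x + y)) ->
  (forall c d, P (pure c d)) -> forall x, P x.
Proof.
move=> P0 PD Pp; elim/quot_ind; elim/quot_ind; elim/msr_ind => [|x y hx hy|n [c d]].
- by rewrite !rmorph0.
- by have := PD _ _ hx hy; rewrite -!rmorphD.
elim: n => [|n IHn]; first by rewrite msrU0 !rmorph0.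
by have := PD _ _ (Pp c d) IHn; rewrite -!rmorphD -msrUD.
Qed.

Fact tens_dot0 : tens_dot 0.
Proof. by exists 0, 0; split; [exact: dot0|exact: dot0|rewrite pure0l]. Qed.
Fact tens_dot1 : tens_dot 1.
Proof. by exists 1, 1; split; [exact: dot1|exact: dot1|]. Qed.
Fact tens_dotM x y : tens_dot x -> tens_dot y -> tens_dot (x * y).
Proof.
move=> [c [d [hc hd ->]]] [c' [d' [hc' hd' ->]]].
by exists (c * c'), (d * d'); split; rewrite ?pureM //; exact: dotM.
Qed.
Fact tens_gen (P : set tens_amb) : P 0 -> P 1 ->
    (forall x y, P x -> P y -> P (x + y)) ->
    (forall x y, P x -> P y -> P (x * y)) ->
    (forall x, tens_dot x -> P x) -> forall x, P x.
Proof.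
move=> P0 P1 PD PM Pd; apply: tens_ind => // c d.
rewrite -[c]mulr1 -[d]mul1r -pureM; apply: (PM _ _ _ _).
  pose Q : set C := fun c => P (pure c 1).
  apply: (@dot_gen C Q) => [||c1 c2|c1 c2|{}c hc]; rewrite /Q.
  - by rewrite pure0l.
  - by [].
  - by rewrite pureDl; exact: PD.
  - by move=> h1 h2; rewrite -[X in pure _ X]mulr1 -pureM; exact: PM.
  - by apply: Pd; exists c, 1; split=> //; exact: dot1.
pose Q : set D := fun d => P (pure 1 d).
apply: (@dot_gen D Q) => [||c1 c2|c1 c2|{}d hc]; rewrite /Q.
- by rewrite pure0r.
- by [].
- by rewrite pureDr; exact: PD.
- by move=> h1 h2; rewrite -[X in pure X _]mulr1 -pureM; exact: PM.
- by apply: Pd; exists 1, d; split=> //; exact: dot1.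
Qed.

Lemma tens_leE x y : tens_le (cls _ x) (cls _ y) <-> gen_le tens_ler x y.
Proof.
have [xr rx] := repr_cls (gen_le_cong tens_ler) x.
have [yr ry] := repr_cls (gen_le_cong tens_ler) y.
split=> h; first exact: gen_le_trans rx (gen_le_trans h yr).
exact: gen_le_trans xr (gen_le_trans h ry).
Qed.
Fact tens_le_refl x : tens_le x x. Proof. exact: gen_le_refl. Qed.
Fact tens_le_anti x y : tens_le x y -> tens_le y x -> x = y.
Proof. by move=> xy yx; rewrite -(cls_repr x) -(cls_repr y); apply/clsP. Qed.
Fact tens_le_trans y x z : tens_le x y -> tens_le y z -> tens_le x z.
Proof. exact: gen_le_trans. Qed.
Fact tens_leD z x y : tens_le x y -> tens_le (x + z) (y + z).
Proof.
elim/quot_ind: x => x; elim/quot_ind: y => y; elim/quot_ind: z => z.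
by rewrite -!rmorphD !tens_leE; exact: gen_leD.
Qed.
Fact tens_leM z x y : tens_le x y -> tens_le (x * z) (y * z).
Proof.
elim/quot_ind: x => x; elim/quot_ind: y => y; elim/quot_ind: z => z.
by rewrite -!rmorphM !tens_leE; exact: gen_leM.
Qed.

Definition tens : ordBlueprint :=
  @OrdBlueprint tens_amb tens_dot tens_le tens_dot0 tens_dot1 tens_dotM tens_gen
    tens_le_refl tens_le_anti tens_le_trans tens_leD tens_leM.

Definition tens_inl_fun (c : C) : tens := pure c 1.
Definition tens_inr_fun (d : D) : tens := pure 1 d.
Fact inl_nmod : nmod_morphism tens_inl_fun.
Proof. by split=> [|x y]; [exact: pure0l|exact: pureDl]. Qed.
Fact inl_monoid : monoid_morphism tens_inl_fun.
Proof. by split=> // x y; rewrite /tens_inl_fun pureM mulr1. Qed.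
Fact inr_nmod : nmod_morphism tens_inr_fun.
Proof. by split=> [|x y]; [exact: pure0r|exact: pureDr]. Qed.
Fact inr_monoid : monoid_morphism tens_inr_fun.
Proof. by split=> // x y; rewrite /tens_inr_fun pureM mulr1. Qed.
HB.instance Definition _ := GRing.isNmodMorphism.Build _ _ tens_inl_fun inl_nmod.
HB.instance Definition _ := GRing.isMonoidMorphism.Build _ _ tens_inl_fun inl_monoid.
HB.instance Definition _ := GRing.isNmodMorphism.Build _ _ tens_inr_fun inr_nmod.
HB.instance Definition _ := GRing.isMonoidMorphism.Build _ _ tens_inr_fun inr_monoid.
Fact inl_dot c : dot c -> dot (tens_inl_fun c).
Proof. by move=> hc; exists c, 1; split=> //; exact: dot1. Qed.
Fact inr_dot d : dot d -> dot (tens_inr_fun d).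
Proof. by move=> hd; exists 1, d; split=> //; exact: dot1. Qed.
Fact inl_le c c' : ble c c' -> ble (tens_inl_fun c) (tens_inl_fun c').
Proof. by move=> h; apply/tens_leE/gen_le_base/tens_lel. Qed.
Fact inr_le d d' : ble d d' -> ble (tens_inr_fun d) (tens_inr_fun d').
Proof. by move=> h; apply/tens_leE/gen_le_base/tens_lerr. Qed.
Definition tens_inl : bpMorph C tens := BpMorph inl_dot inl_le.
Definition tens_inr : bpMorph D tens := BpMorph inr_dot inr_le.

Section Universal.
Variables (X : ordBlueprint) (p : bpMorph C X) (q : bpMorph D X).
Hypothesis pq : forall b, p (f b) = q (g b).
Let h0 := msr_morph (GRing.natmul (1 : X))
  (fun cd : mulmon (C * D)%type => p cd.1 * q cd.2).
Let h0_nmod : nmod_morphism h0 := msr_morph_is_nmod _ _.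
Let h0_monoid : monoid_morphism h0.
Proof.
apply: msr_morph_is_monoid; first by rewrite !rmorph1 mulr1.
by move=> x y; rewrite mulrACA -!rmorphM.
Qed.
HB.instance Definition _ := GRing.isNmodMorphism.Build _ _ h0 h0_nmod.
HB.instance Definition _ := GRing.isMonoidMorphism.Build _ _ h0 h0_monoid.
Let h0r : {rmorphism T0 -> X} := h0.
Let h0u c d : h0r (u c d) = p c * q d.
Proof. by apply: etrans (msr_morphU _ _ _ _) _; rewrite mul1r. Qed.
Let h0E x y : gen_cong tens_rel x y -> h0r x = h0r y.
Proof.
apply: gen_eq_morph => {x y} _ _ [c c' d|c d d'|d|c|b c d];
  rewrite ?rmorphD ?rmorph0 !h0u ?rmorphD ?rmorph0 ?rmorphM.
- by rewrite mulrDl.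
- by rewrite mulrDr.
- by rewrite mul0r.
- by rewrite mulr0.
- by rewrite -mulrA pq.
Qed.
Let h1 : tens_sr -> X := quot_lift h0r.
Let h1_nmod : nmod_morphism h1 := quot_lift_is_nmod h0E.
Let h1_monoid : monoid_morphism h1 := quot_lift_is_monoid h0E.
HB.instance Definition _ := GRing.isNmodMorphism.Build _ _ h1 h1_nmod.
HB.instance Definition _ := GRing.isMonoidMorphism.Build _ _ h1 h1_monoid.
Let h1r : {rmorphism tens_sr -> X} := h1.
Let h1u c d : h1r (pure_sr c d) = p c * q d.
Proof. by apply: etrans (quot_liftE h0E _) _; exact: h0u. Qed.
Let h1_le x y : gen_le tens_ler x y -> ble (h1r x) (h1r y).
Proof.
elim=> {x y} [_ _ []||y x z _ l _ l'|z x y _ l|z x y _ l].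
- by move=> c c' l; rewrite !h1u; apply/bleM/bpm_le.
- by move=> c c' l; rewrite !h1u ![p 1 * _]mulrC; apply/bleM/bpm_le.
- by move=> x; exact: ble_refl.
- exact: ble_trans l l'.
- by rewrite !rmorphD; exact: bleD.
- by rewrite !rmorphM; exact: bleM.
Qed.
Let h1E x y : gen_le_cong tens_ler x y -> h1r x = h1r y.
Proof. by move=> [/h1_le xy /h1_le yx]; exact: ble_anti. Qed.
Definition tens_univ_fun : tens -> X := quot_lift h1r.
Fact tens_univ_nmod : nmod_morphism tens_univ_fun.
Proof. exact: quot_lift_is_nmod. Qed.
Fact tens_univ_monoid : monoid_morphism tens_univ_fun.
Proof. exact: quot_lift_is_monoid. Qed.
HB.instance Definition _ := GRing.isNmodMorphism.Build _ _ tens_univ_fun tens_univ_nmod.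
HB.instance Definition _ := GRing.isMonoidMorphism.Build _ _ tens_univ_fun tens_univ_monoid.
Lemma tens_univE c d : tens_univ_fun (pure c d) = p c * q d.
Proof. by apply: etrans (quot_liftE h1E _) _; exact: h1u. Qed.
Fact tens_univ_dot x : dot x -> dot (tens_univ_fun x).
Proof. by move=> [c [d [hc hd ->]]]; rewrite tens_univE; apply: dotM; exact: bpm_dot. Qed.
Fact tens_univ_le x y : ble x y -> ble (tens_univ_fun x) (tens_univ_fun y).
Proof. by move=> l; exact: h1_le. Qed.
Definition tens_univ : bpMorph tens X := BpMorph tens_univ_dot tens_univ_le.
End Universal.

Lemma tens_pushout : (forall b, tens_inl (f b) = tens_inr (g b)) /\
  forall (X : ordBlueprint) (p : bpMorph C X) (q : bpMorph D X),
    (forall b, p (f b) = q (g b)) ->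
    exists h : bpMorph tens X,
      [/\ forall c, h (tens_inl c) = p c, forall d, h (tens_inr d) = q d
        & forall h' : bpMorph tens X, (forall c, h' (tens_inl c) = p c) ->
            (forall d, h' (tens_inr d) = q d) -> h' =1 h].
Proof.
split=> [b|X p q pq]; first exact: pure_bal.
exists (tens_univ pq); split=> [c|d|h' hl hr].
- by apply: etrans (tens_univE _ _ _) _; rewrite rmorph1 mulr1.
- by apply: etrans (tens_univE _ _ _) _; rewrite rmorph1 mul1r.
apply: bpMorph_ext => _ [c [d [_ _ ->]]].
apply: etrans (esym (tens_univE pq c d)).
rewrite -hl -hr -rmorphM; congr (h' _); apply/esym.
by apply: etrans (pureM _ _ _ _) _; rewrite mulr1 mul1r.
Qed.
End Tensor.

Section Toric.
Variable A : comMonoidType.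
Definition fin_gen : Prop := exists s : seq A, forall P : set A, P 1%g ->
  (forall a b, P a -> P b -> P (a * b)%g) ->
  (forall a, a \in s -> P a) -> forall a, P a.

Section Embedding.
Variables (G : groupType) (j : A -> G).
Definition monoid_embedding : Prop :=
  [/\ injective j, j 1%g = 1%g & {morph j : a b / (a * b)%g}].
(* membership in the subgroup A^gp of G generated by j(A) *)
Definition gp (g : G) : Prop := forall P : set G, P 1%g ->
  (forall x y, P x -> P y -> P (x * y)%g) -> (forall x, P x -> P x^-1%g) ->
  (forall a, P (j a)) -> P g.
Definition saturated : Prop := forall (g : G) (n : nat), gp g -> (1 <= n)%N ->
  (exists a, j a = (g ^+ n)%g) -> exists a, j a = g.
End Embedding.

Definition affine_toric : Prop := fin_gen /\
  exists (G : groupType) (j : A -> G),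
    [/\ commutative (@monoid.mul G), monoid_embedding j & saturated j].
End Toric.

Record nonarch_absval (k : fieldType) (R : realType) := NonarchAbsval {
  av :> k -> tropR R;
  av0 : tval (av 0) = 0;
  av1 : tval (av 1) = 1;
  avM : forall a b, tval (av (a * b)) = tval (av a) * tval (av b);
  avD : forall a b, tval (av (a + b)) <= Num.max (tval (av a)) (tval (av b))
}.

Section ValuationMorphism.
Variables (k : fieldType) (Rr : realType) (v : nonarch_absval k Rr).

Lemma avN a : tval (v (- a)) = tval (v a).
Proof.
have /eqP : tval (v (-1)) ^+ 2 = 1 by rewrite expr2 -avM mulrNN mulr1 av1.
rewrite sqrf_eq1 => /orP[] /eqP h; first by rewrite -mulN1r avM h mul1r.
by have := tval_ge0 (v (-1)); rewrite h oppr_ge0 ler10.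
Qed.

Lemma av_max_twice a b : max_twice (tval (v a)) (tval (v b)) (tval (v (a + b))).
Proof.
have hc := avD v a b.
have ha : tval (v a) <= Num.max (tval (v (a + b))) (tval (v b)).
  by have := avD v (a + b) (- b); rewrite addrK avN.
have hb : tval (v b) <= Num.max (tval (v (a + b))) (tval (v a)).
  by have := avD v (a + b) (- a); rewrite addrAC subrr add0r avN.
move: hc ha hb; rewrite !le_max.
have [ab|ab|ab] := ltgtP (tval (v a)) (tval (v b)); rewrite ?orbF ?orbT.
- move=> c _ h; apply: Or33; split; last exact: ltW.
  by apply: le_anti; rewrite h /= ; case/orP: c => // c; apply: le_trans c (ltW ab).
- move=> c h _; apply: Or32; split; last exact: ltW.
  by apply: le_anti; rewrite h /= ; case/orP: c => // c; apply: le_trans c (ltW ab).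
by move=> c _ _; apply: Or31; split=> //; case/orP: c => //; rewrite ab.
Qed.

Definition av_phi (c : mulmon k) : bpT Rr := emb (v c : mulmon (tropR Rr)).
Fact av_phi0 : av_phi mzero = 0.
Proof. by apply: etrans (emb0 _); congr emb; apply: val_inj; exact: av0. Qed.
Fact av_phi1 : av_phi 1%g = 1.
Proof. by apply: etrans (emb1 _); congr emb; apply: val_inj; exact: av1. Qed.
Fact av_phiM : {morph av_phi : a b / (a * b)%g >-> a * b}.
Proof.
by move=> a b; rewrite /av_phi -embM; congr emb; apply: val_inj; exact: avM.
Qed.
Fact av_phi_dot c : dot (av_phi c). Proof. by exists (v c). Qed.
Fact av_phi_le x y : mon_rel x y ->
  ble (plus_morph av_phi0 av_phi1 av_phiM x) (plus_morph av_phi0 av_phi1 av_phiM y).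
Proof.
move=> [a [b [c [-> -> ->]]]]; rewrite rmorphD !plus_morphE.
apply: gen_le_base; exists (v a), (v b), (v (a + b)); split=> //.
exact: av_max_twice.
Qed.
Definition av_morph : bpMorph (mon k) (bpT Rr) :=
  free_morph (@mon_relP k) av_phi_dot av_phi_le.
End ValuationMorphism.

Section ToricBlueprint.
Variables (k : fieldType) (A : comMonoidType) (R : comPzRingType).
Variable iota : {rmorphism msr k A -> R}.

Definition Bpred : pred R := fun x => `[< exists c a, x = iota (msrU c a) >].
Definition Bdot : Type := {x : R | Bpred x}.
HB.instance Definition _ := Choice.on Bdot.
HB.instance Definition _ := SubChoice.on Bdot.

Fact Bterm_subproof c a : Bpred (iota (msrU c a)).
Proof. by apply/asboolP; exists c, a. Qed.
(* iota (c a) as an element of B^bullet *)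
Definition Bterm (c : k) (a : A) : Bdot := exist Bpred _ (Bterm_subproof c a).

Fact Bmul_subproof (x y : Bdot) : Bpred (val x * val y).
Proof.
have /asboolP[c [a xE]] := valP x; have /asboolP[d [b yE]] := valP y.
by apply/asboolP; exists (c * d), (a * b)%g; rewrite xE yE -rmorphM msrUM.
Qed.
Definition Bmul (x y : Bdot) : Bdot := exist Bpred _ (Bmul_subproof x y).

Fact BmulA : associative Bmul.
Proof. by move=> x y z; apply: val_inj; rewrite /= mulrA. Qed.
Fact BmulC : commutative Bmul.
Proof. by move=> x y; apply: val_inj; rewrite /= mulrC. Qed.
Fact Bmul1 : left_id (Bterm 1 1%g) Bmul.
Proof. by move=> x; apply: val_inj; rewrite /= rmorph1 mul1r. Qed.
Fact Bmulr1 : right_id (Bterm 1 1%g) Bmul.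
Proof. by move=> x; rewrite BmulC Bmul1. Qed.
Fact Bmul0 : left_zero (Bterm 0 1%g) Bmul.
Proof. by move=> x; apply: val_inj; rewrite /= msrU0 rmorph0 mul0r. Qed.
HB.instance Definition _ := isMonoid.Build Bdot BmulA Bmul1 Bmulr1.
HB.instance Definition _ := Monoid_isComMonoid.Build Bdot BmulC.
HB.instance Definition _ := ComMonoid_hasAbsorbing.Build Bdot Bmul0.

Definition B_rel (x y : plus Bdot) : Prop :=
  exists (c : k) (a : A) (s : seq (k * A)),
    [/\ iota (msrU c a) = \sum_(p <- s) iota (msrU p.1 p.2),
        x = emb (Bterm c a) & y = \sum_(p <- s) emb (Bterm p.1 p.2)].

Lemma val_Bdot0 : val (mzero : Bdot) = 0.
Proof. by rewrite /= msrU0 rmorph0. Qed.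

Lemma emb_sum_eqlt (x : Bdot) (t : seq Bdot) : val x = \sum_(y <- t) val y ->
  emb x = \sum_(y <- t) emb y \/ (len (emb x) < len (\sum_(y <- t) emb y))%N.
Proof.
move=> xt; set t' := [seq y <- t | y != mzero].
have nz : all (fun y => y != mzero) t' by exact: filter_all.
have {}xt : val x = \sum_(y <- t') val y.
  rewrite xt big_filter [RHS]big_mkcond; apply: eq_bigr => y _.
  by case: eqP => //= ->; exact: val_Bdot0.
have -> : \sum_(y <- t) emb y = \sum_(y <- t') emb y.
  rewrite big_filter [RHS]big_mkcond; apply: eq_bigr => y _.
  by case: eqP => //= ->; rewrite emb0.
case: t' nz xt => [|y [|z t']] nz; rewrite !(big_cons, big_nil).
- by move=> x0; left; rewrite -emb0; congr emb; apply: val_inj; rewrite x0 val_Bdot0.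
- by rewrite !addr0 => xy; left; congr emb; exact: val_inj.
move=> _; right; move: nz => /= /and3P[ny nz _].
by rewrite !lenD !len_emb ny nz; case: (_ != _).
Qed.

Fact B_relP x y : B_rel x y -> forall m,
  x * emb m = y * emb m \/ (len (x * emb m) < len (y * emb m))%N.
Proof.
move=> [c [a [s [E -> ->]]]] m; rewrite mulr_suml -embM.
under eq_bigr do rewrite -embM.
rewrite -(big_map (fun p : k * A => Bterm p.1 p.2 * m)%g xpredT (@emb _)).
apply: emb_sum_eqlt; rewrite big_map /= E mulr_suml.
by apply: eq_bigr.
Qed.

Definition assocB : ordBlueprint := free_bp B_relP.

Definition str_phi (c : mulmon k) : assocB := emb (Bterm c 1%g).
Fact str_phi0 : str_phi mzero = 0. Proof. exact: emb0. Qed.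
Fact str_phi1 : str_phi 1%g = 1. Proof. by []. Qed.
Fact str_phiM : {morph str_phi : a b / (a * b)%g >-> a * b}.
Proof.
move=> a b; rewrite /str_phi -embM; congr emb; apply: val_inj => /=.
by rewrite -rmorphM msrUM mulg1.
Qed.
Fact str_phi_dot c : dot (str_phi c). Proof. by exists (Bterm c 1%g). Qed.
Fact str_phi_le x y : mon_rel x y ->
  ble (plus_morph str_phi0 str_phi1 str_phiM x) (plus_morph str_phi0 str_phi1 str_phiM y).
Proof.
move=> [a [b [c [-> -> ->]]]]; rewrite rmorphD !plus_morphE.
apply: gen_le_base; exists (a + b), 1%g, [:: (a, 1%g); (b, 1%g)].
by split=> //; rewrite !big_cons big_nil ?addr0 // msrUD rmorphD.
Qed.
Definition str_morph : bpMorph (mon k) assocB :=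
  free_morph (@mon_relP k) str_phi_dot str_phi_le.
End ToricBlueprint.

Section Bend.
Variables (k : fieldType) (Rr : realType) (v : nonarch_absval k Rr).
Variables (A : comMonoidType) (R : comPzRingType).
Variable iota : {rmorphism msr k A -> R}.

Definition bend_rel (x y : msr (tropR Rr) A) : Prop :=
  exists (c : k) (a : A) (s : seq (k * A)),
    [/\ iota (msrU c a) = \sum_(p <- s) iota (msrU p.1 p.2),
        x = msrU (v c) a + \sum_(p <- s) msrU (v p.1) p.2
      & y = \sum_(p <- s) msrU (v p.1) p.2].

Definition bendGG : Type := quot (gen_cong bend_rel).
HB.instance Definition _ := GRing.ComPzSemiRing.on bendGG.
Definition bend_cls (x : msr (tropR Rr) A) : bendGG := cls _ x.

Definition trop : ordBlueprint := tens (str_morph iota) (av_morph v).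
(* the pure tensor b (x) t of B (x)_k T *)
Definition trop_pure (b : Bdot iota) (t : tropR Rr) : trop :=
  pure (str_morph iota) (av_morph v) (emb b) (emb (t : mulmon (tropR Rr))).

Definition tropBB : ordBlueprint := tens (F1_init trop) (F1_init BB).
(* the canonical map x |-> x (x) 1 *)
Definition tropBB_cls (x : trop) : tropBB := pure (F1_init trop) (F1_init BB) x 1.
End Bend.

(* Main.v *)
(** Over [BB], the hyperfield relations [0 <= 1 + 1] and [s <= t + t] (for
    [s <= t]) make the order of [tropBB] the natural one, [x <= y] iff
    [x + y = y], and turn sums in T into maxima. Hence [t a |-> iota a (x) t]
    is defined on the tropical polynomials and kills the bend relations, these
    being the relations of B read in the natural order. Conversely the
    bend, with its natural order, is an ordered blueprint receiving B, T and
    [BB], and the universal property of the two tensor products gives the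
    inverse. *)

Require Import Defs.
From HB Require Import structures.
From mathcomp Require Import all_boot all_order all_algebra finmap.
From mathcomp Require Import boolp classical_sets reals.
Import Order.TTheory GRing.Theory Num.Theory.
Local Open Scope ring_scope.

Set Implicit Arguments.
Unset Strict Implicit.
Unset Printing Implicit Defensive.

(** Since [dot] generates the ambient semiring, no order on the target is involved; this covers
    composites through maps known only as semiring morphisms, such as [bend_tropBB]. *)
Lemma rmorph_dot_ext (B : ordBlueprint) (S : comPzSemiRingType)
    (f g : {rmorphism B -> S}) : (forall x, dot x -> f x = g x) -> f =1 g.
Proof.
move=> fg; apply: dot_gen => //; rewrite ?rmorph0 ?rmorph1 //.
- by move=> x y hx hy; rewrite !rmorphD hx hy.
- by move=> x y hx hy; rewrite !rmorphM hx hy.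
Qed.

Lemma idem1_addrr (S : comPzSemiRingType) : 1 + 1 = 1 :> S ->
  forall x : S, x + x = x.
Proof. by move=> h x; rewrite -[x]mul1r -mulrDl h. Qed.

Lemma taddrr (R : realType) (t : tropR R) : t + t = t.
Proof. by apply: val_inj; exact: maxxx. Qed.

(** * Idempotent semirings as ordered blueprints *)

Section NaturalOrder.
Variables (S : comPzSemiRingType) (idem : 1 + 1 = 1 :> S).

Definition nat_ble (x y : S) : Prop := x + y = y.

Fact nat_ble_refl x : nat_ble x x.
Proof. exact: idem1_addrr. Qed.
Fact nat_ble_anti x y : nat_ble x y -> nat_ble y x -> x = y.
Proof. by rewrite /nat_ble addrC => xy <-. Qed.
Fact nat_ble_trans y x z : nat_ble x y -> nat_ble y z -> nat_ble x z.
Proof. by rewrite /nat_ble => xy <-; rewrite addrA xy. Qed.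
Fact nat_bleD z x y : nat_ble x y -> nat_ble (x + z) (y + z).
Proof. by rewrite /nat_ble addrACA => ->; rewrite idem1_addrr. Qed.
Fact nat_bleM z x y : nat_ble x y -> nat_ble (x * z) (y * z).
Proof. by rewrite /nat_ble -mulrDl => ->. Qed.

(** With [setT] as underlying monoid, a morphism into [nat_bp] is just an order-preserving semiring
    morphism. *)
Definition nat_bp : ordBlueprint :=
  @OrdBlueprint S setT nat_ble I I (fun _ _ _ _ => I)
    (fun _ _ _ _ _ h x => h x I)
    nat_ble_refl nat_ble_anti nat_ble_trans nat_bleD nat_bleM.

Definition BB_phi (b : bool2) : S := if b then 1 else 0.
Fact BB_phi_nmod : nmod_morphism BB_phi.
Proof.
by split=> // -[] [] /=; rewrite /BB_phi /= ?idem ?addr0 ?add0r.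
Qed.
Fact BB_phi_monoid : monoid_morphism BB_phi.
Proof. by split=> // -[] [] /=; rewrite /BB_phi /= ?mulr1 ?mulr0. Qed.
HB.instance Definition _ :=
  GRing.isNmodMorphism.Build _ _ BB_phi BB_phi_nmod.
HB.instance Definition _ :=
  GRing.isMonoidMorphism.Build _ _ BB_phi BB_phi_monoid.
Definition BB_rmorph : {rmorphism BB -> nat_bp} := BB_phi.
Fact BB_rmorph_le x y : ble x y -> ble (BB_rmorph x) (BB_rmorph y).
Proof. by move=> ->; exact: ble_refl. Qed.
Definition BB_morph : bpMorph BB nat_bp :=
  @BpMorph _ _ BB_rmorph (fun _ _ => I) BB_rmorph_le.
End NaturalOrder.

(** * Order and addition in an idempotent algebra over the tropical hyperfield *)

Section IdempotentTropicalAlgebra.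
Variables (Rr : realType) (W : ordBlueprint) (h : bpMorph (bpT Rr) W).
Hypothesis idem : 1 + 1 = 1 :> W.
Local Notation e t := (emb (t : mulmon (tropR Rr)) : bpT Rr).

(** In T, [s <= t + t] because the maximum of [t, t, s] is attained twice; in [W] the right side
    collapses to [t]. *)
Lemma bpT_idem_le (s t : tropR Rr) : (s : Rr) <= (t : Rr) -> ble (h (e s)) (h (e t)).
Proof.
move=> st; rewrite -[h (e t)]idem1_addrr // -rmorphD; apply: bpm_le.
by apply: gen_le_base; exists t, t, s; split=> //; apply: Or31.
Qed.

(** From [0 <= 1] every element is nonnegative, so [y <= x + y], while [x + y <= y + y = y];
    antisymmetry concludes. *)
Lemma idem_ble_add (x y : W) : ble x y -> x + y = y.
Proof.
have z1 : ble (0 : W) 1.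
  have := @bpT_idem_le 0 1 ler01.
  have -> : e 0 = 0 by exact: emb0.
  have -> : e 1 = 1 by exact: emb1.
  by rewrite rmorph0 rmorph1.
have z (u : W) : ble 0 u by have := bleM u z1; rewrite mul0r mul1r.
move=> xy; apply: ble_anti.
  by rewrite -[X in ble _ X](idem1_addrr idem); exact: bleD.
by rewrite -[X in ble X _]add0r; exact: bleD.
Qed.

Lemma bpT_idemD (s t : tropR Rr) : h (e (s + t)) = h (e s) + h (e t).
Proof.
wlog st : s t / (s : Rr) <= (t : Rr).
  move=> H; case: (leP (s : Rr) (t : Rr)) => [|/ltW]; first exact: H.
  by move=> /H; rewrite addrC => ->; rewrite addrC.
rewrite (idem_ble_add (bpT_idem_le st)); congr (h (emb _)).
by apply: val_inj; exact: max_r.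
Qed.
End IdempotentTropicalAlgebra.

Definition bpMorph_comp (B C D : ordBlueprint) (g : bpMorph C D) (f : bpMorph B C) :
  bpMorph B D := @BpMorph B D (g \o f)
    (fun x hx => bpm_dot g (bpm_dot f hx)) (fun x y l => bpm_le g (bpm_le f l)).

Lemma free_morph_embM (M : monoid0Type) (r : plus M -> plus M -> Prop) hr
    (C : ordBlueprint) (h : bpMorph (@free_bp M r hr) C) (x y : M) :
  h (emb (x * y)%g) = h (emb x) * h (emb y).
Proof. by rewrite -rmorphM -embM. Qed.

(** * Maps out of the bend into an idempotent blueprint *)

Section BendUniversal.
Variables (Rr : realType) (k : fieldType) (v : nonarch_absval k Rr).
Variables (A : comMonoidType) (R : comPzRingType).
Variable iota : {rmorphism msr k A -> R}.

Lemma str_morphE (c : k) :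
  str_morph iota (emb (c : mulmon k)) = emb (Bterm iota c 1%g).
Proof.
exact: (plus_morphE (str_phi0 iota) (str_phi1 iota) (@str_phiM _ _ _ iota)).
Qed.
Lemma av_morphE (c : k) :
  av_morph v (emb (c : mulmon k)) = emb (v c : mulmon (tropR Rr)).
Proof. exact: (plus_morphE (av_phi0 v) (av_phi1 v) (@av_phiM _ _ v)). Qed.

Variables (W : ordBlueprint) (idem : 1 + 1 = 1 :> W).
Variables (p : bpMorph (assocB iota) W) (q : bpMorph (bpT Rr) W).
Hypothesis pq : forall b, p (str_morph iota b) = q (av_morph v b).
Local Notation eT t := (emb (t : mulmon (tropR Rr)) : bpT Rr).

(** Factor [c a] as [(1 a)(c 1)]: the second factor comes from the base field, so [pq] moves it to
    the tropical side, where it becomes [v c]. *)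
Lemma bend_scalar c a : p (emb (Bterm iota c a)) =
  p (emb (Bterm iota 1 a)) * q (eT (v c)).
Proof.
have -> : Bterm iota c a = (Bterm iota 1 a * Bterm iota c 1)%g.
  by apply: val_inj; rewrite /= -rmorphM msrUM mul1r mulg1.
by rewrite free_morph_embM -av_morphE -pq str_morphE.
Qed.

Definition bend_sigma (t : tropR Rr) : W := q (eT t).
(** Sums in T^+ are formal, so [emb] alone is not additive on [tropR]; idempotence of [W] turns them
    into maxima. *)
Fact bend_sigma_nmod : nmod_morphism bend_sigma.
Proof.
split=> [|s t]; last exact: (bpT_idemD q idem).
by apply: etrans (rmorph0 q); congr (q _); exact: emb0.
Qed.
Fact bend_sigma_monoid : monoid_morphism bend_sigma.
Proof.
split=> [|s t]; first exact: (rmorph1 q).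
exact: (@free_morph_embM (mulmon (tropR Rr))).
Qed.
HB.instance Definition _ :=
  GRing.isNmodMorphism.Build _ _ bend_sigma bend_sigma_nmod.
HB.instance Definition _ :=
  GRing.isMonoidMorphism.Build _ _ bend_sigma bend_sigma_monoid.

Definition bend_phi (a : A) : W := p (emb (Bterm iota 1 a)).
Fact bend_phi1 : bend_phi 1%g = 1. Proof. exact: (rmorph1 p). Qed.
Fact bend_phiM : {morph bend_phi : a b / (a * b)%g >-> a * b}.
Proof.
move=> a b; rewrite /bend_phi -free_morph_embM; congr (p (emb _)).
by apply: val_inj; rewrite /= -rmorphM msrUM mul1r.
Qed.

Definition bend_univ0 : msr (tropR Rr) A -> W := msr_morph bend_sigma bend_phi.
Fact bend_univ0_nmod : nmod_morphism bend_univ0.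
Proof. exact: msr_morph_is_nmod. Qed.
Fact bend_univ0_monoid : monoid_morphism bend_univ0.
Proof. exact: msr_morph_is_monoid bend_phi1 bend_phiM. Qed.
HB.instance Definition _ :=
  GRing.isNmodMorphism.Build _ _ bend_univ0 bend_univ0_nmod.
HB.instance Definition _ :=
  GRing.isMonoidMorphism.Build _ _ bend_univ0 bend_univ0_monoid.

Lemma bend_univ0U t a :
  bend_univ0 (msrU t a) = p (emb (Bterm iota 1 a)) * q (eT t).
Proof. by apply: etrans (msr_morphU _ _ _ _) _; rewrite mulrC. Qed.

(** By [bend_scalar] each monomial [v(c) a] goes to the image under [p] of an element of B. A bend
    relation thus becomes the image of a generating inequality of B, rewritten by [idem_ble_add]. *)
Lemma bend_univ0_cong x y :
  gen_cong (bend_rel v iota) x y -> bend_univ0 x = bend_univ0 y.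
Proof.
apply: (gen_eq_morph (f := bend_univ0)) => {x y} _ _ [c [a [s [E -> ->]]]].
rewrite rmorphD rmorph_sum /= bend_univ0U -bend_scalar.
under eq_bigr do rewrite bend_univ0U -bend_scalar.
rewrite -(rmorph_sum p); apply: (idem_ble_add q idem).
by apply: bpm_le; apply: gen_le_base; exists c, a, s.
Qed.

Definition bend_univ_fun (x : bendGG v iota) : W := quot_lift bend_univ0 x.
Fact bend_univ_nmod : nmod_morphism bend_univ_fun.
Proof. exact: quot_lift_is_nmod bend_univ0_cong. Qed.
Fact bend_univ_monoid : monoid_morphism bend_univ_fun.
Proof. exact: quot_lift_is_monoid bend_univ0_cong. Qed.
HB.instance Definition _ :=
  GRing.isNmodMorphism.Build _ _ bend_univ_fun bend_univ_nmod.
HB.instance Definition _ :=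
  GRing.isMonoidMorphism.Build _ _ bend_univ_fun bend_univ_monoid.
Definition bend_univ : {rmorphism bendGG v iota -> W} := bend_univ_fun.

Lemma bend_univU t a : bend_univ (bend_cls v iota (msrU t a)) =
  p (emb (Bterm iota 1 a)) * q (eT t).
Proof. by apply: etrans (quot_liftE bend_univ0_cong _) _; exact: bend_univ0U. Qed.
End BendUniversal.

(** * The bend as a target for B and the tropical hyperfield *)

Section BendBlueprint.
Variables (Rr : realType) (k : fieldType) (v : nonarch_absval k Rr).
Variables (A : comMonoidType) (R : comPzRingType).
Variable iota : {rmorphism msr k A -> R}.
Local Notation BD := (bendGG v iota).
Local Notation eT t := (emb (t : mulmon (tropR Rr)) : bpT Rr).

Local Notation bcls := (bend_cls v iota).
Fact bcls_nmod : nmod_morphism bcls. Proof. exact: cls_is_nmod. Qed.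
Fact bcls_monoid : monoid_morphism bcls. Proof. exact: cls_is_monoid. Qed.
HB.instance Definition _ := GRing.isNmodMorphism.Build _ BD bcls bcls_nmod.
HB.instance Definition _ := GRing.isMonoidMorphism.Build _ BD bcls bcls_monoid.

Lemma bend_idem : 1 + 1 = 1 :> BD.
Proof.
rewrite -(rmorph1 bcls) -rmorphD; congr bcls.
by rewrite -[LHS]msrUD taddrr.
Qed.

Local Notation X := (nat_bp bend_idem).

Lemma bcls_rel c a (s : seq (k * A)) :
  iota (msrU c a) = \sum_(p <- s) iota (msrU p.1 p.2) ->
  bcls (msrU (v c) a) + \sum_(p <- s) bcls (msrU (v p.1) p.2)
    = \sum_(p <- s) bcls (msrU (v p.1) p.2).
Proof.
move=> E; rewrite -(rmorph_sum bcls) -rmorphD; apply/clsP.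
by apply: gen_eq_base; exists c, a, s.
Qed.

(** The equality in R, read in both directions, gives two one-term bend relations [x + y = y] and
    [y + x = x]. *)
Lemma bcls_eq c a d b : iota (msrU c a) = iota (msrU d b) ->
  bcls (msrU (v c) a) = bcls (msrU (v d) b).
Proof.
move=> E; have := @bcls_rel c a [:: (d, b)]; have := @bcls_rel d b [:: (c, a)].
rewrite !big_seq1 /= => /(_ (esym E)) h1 /(_ E) h2.
by rewrite -h1 addrC h2.
Qed.

Fact Bdot_ex (x : Bdot iota) : exists p : k * A, x = Bterm iota p.1 p.2.
Proof.
by have /asboolP[c [a xE]] := valP x; exists (c, a); exact: val_inj.
Qed.
(** An element of B may be [iota(c a)] for several pairs [(c, a)]; one is chosen, and [bcls_eq]
    makes the value independent of the choice. *)
Definition bend_B_phi (x : Bdot iota) : X :=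
  let p := sval (cid (Bdot_ex x)) in bcls (msrU (v p.1) p.2).
Lemma bend_B_phiE c a : bend_B_phi (Bterm iota c a) = bcls (msrU (v c) a).
Proof.
rewrite /bend_B_phi; case: cid => -[d b] /= E; apply: bcls_eq.
exact: (esym (congr1 val E)).
Qed.

Lemma av_zero : v 0 = 0. Proof. by apply: val_inj; exact: av0. Qed.
Lemma av_one : v 1 = 1. Proof. by apply: val_inj; exact: av1. Qed.
Lemma av_mul c d : v (c * d) = v c * v d.
Proof. by apply: val_inj; exact: avM. Qed.

Fact bend_B_phi0 : bend_B_phi mzero = 0.
Proof. by rewrite bend_B_phiE av_zero msrU0; exact: rmorph0. Qed.
Fact bend_B_phi1 : bend_B_phi 1%g = 1.
Proof. by rewrite bend_B_phiE av_one; exact: rmorph1. Qed.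
Fact bend_B_phiM : {morph bend_B_phi : a b / (a * b)%g >-> a * b}.
Proof.
move=> x y; have [[c a] ->] := Bdot_ex x; have [[d b] ->] := Bdot_ex y.
have -> : (Bterm iota c a * Bterm iota d b)%g = Bterm iota (c * d) (a * b)%g.
  by apply: val_inj; rewrite /= -rmorphM msrUM.
by rewrite !bend_B_phiE av_mul -msrUM; exact: rmorphM.
Qed.
Fact bend_B_phi_le x y : B_rel x y ->
  @ble X (plus_morph bend_B_phi0 bend_B_phi1 bend_B_phiM x)
         (plus_morph bend_B_phi0 bend_B_phi1 bend_B_phiM y).
Proof.
move=> [c [a [s [E -> ->]]]]; rewrite rmorph_sum plus_morphE bend_B_phiE.
under eq_bigr do rewrite plus_morphE bend_B_phiE.
exact: bcls_rel.
Qed.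
Definition bend_B : bpMorph (assocB iota) X :=
  @free_morph _ _ (@B_relP _ _ _ iota) X _ _ _ _ (fun=> I) bend_B_phi_le.
Lemma bend_BE c a : bend_B (emb (Bterm iota c a)) = bcls (msrU (v c) a).
Proof.
exact: etrans (plus_morphE bend_B_phi0 bend_B_phi1 bend_B_phiM _) (bend_B_phiE c a).
Qed.

Definition bend_T_phi (t : mulmon (tropR Rr)) : X := bcls (msrU (t : tropR Rr) 1%g).
Fact bend_T_phi0 : bend_T_phi mzero = 0.
Proof. by rewrite /bend_T_phi msrU0; exact: rmorph0. Qed.
Fact bend_T_phi1 : bend_T_phi 1%g = 1.
Proof. exact: rmorph1. Qed.
Fact bend_T_phiM : {morph bend_T_phi : a b / (a * b)%g >-> a * b}.
Proof.
move=> s t; rewrite /bend_T_phi -(mul1g 1%g) -[RHS](rmorphM bcls) msrUM.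
by rewrite !mul1g.
Qed.
Fact bend_T_phi_le x y : trop_rel x y ->
  @ble X (plus_morph bend_T_phi0 bend_T_phi1 bend_T_phiM x)
         (plus_morph bend_T_phi0 bend_T_phi1 bend_T_phiM y).
Proof.
move=> [a [b [c [abc -> ->]]]]; rewrite rmorphD !plus_morphE.
have phiD (s t : tropR Rr) : bend_T_phi s + bend_T_phi t = bend_T_phi (s + t).
  by rewrite /bend_T_phi msrUD; exact: (esym (rmorphD bcls _ _)).
(* When the maximum of [a, b, c] is attained twice, [a] or [b] attains it, so [c <= max(a, b)]. *)
suff abc_eq : c + (a + b) = a + b by rewrite /ble /= /nat_ble !phiD abc_eq.
apply: val_inj; apply: max_r.
by rewrite le_max; case: abc => -[E h]; rewrite -?E ?h ?lexx ?orbT.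
Qed.
Definition bend_T : bpMorph (bpT Rr) X :=
  @free_morph _ _ (@trop_relP _) X _ _ _ _ (fun=> I) bend_T_phi_le.
Lemma bend_TE t : bend_T (eT t) = bcls (msrU t 1%g).
Proof. exact: (plus_morphE bend_T_phi0 bend_T_phi1 bend_T_phiM). Qed.

(** It suffices to compare on scalars [c], where both composites give the class of the constant
    [v c]. *)
Lemma bend_BT_bal b : bend_B (str_morph iota b) = bend_T (av_morph v b).
Proof.
move: b; apply: (@rmorph_dot_ext (mon k) X (bend_B \o str_morph iota)
  (bend_T \o av_morph v)) => _ [c _ <-] /=.
by rewrite str_morphE av_morphE bend_BE bend_TE.
Qed.

(** Monomials span the bend additively; this yields both one inverse identity and the uniqueness of
    the canonical map. *)
Lemma bend_ext (S : comPzSemiRingType) (f g : {rmorphism BD -> S}) :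
  (forall t a, f (bcls (msrU t a)) = g (bcls (msrU t a))) -> f =1 g.
Proof.
move=> fg; elim/quot_ind => x; rewrite -/(bcls x).
elim/msr_ind: x => [|x y hx hy|t a]; last exact: fg.
- by rewrite !rmorph0.
- by rewrite !rmorphD hx hy.
Qed.
End BendBlueprint.

(** * The two inverse morphisms *)

Section BendIso.
Variables (Rr : realType) (k : fieldType) (v : nonarch_absval k Rr).
Variables (A : comMonoidType) (R : comPzRingType).
Variable iota : {rmorphism msr k A -> R}.

Local Notation W := (tropBB v iota).
Local Notation X := (nat_bp (bend_idem v iota)).
Local Notation eT t := (emb (t : mulmon (tropR Rr)) : bpT Rr).

Lemma tropBB_idem : 1 + 1 = 1 :> W.
(* The sum is formed in the second factor, where [1 + 1] computes to [1] in [BB]. *)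
Proof. by rewrite -pure11 -pureDr. Qed.

Definition B_tropBB : bpMorph (assocB iota) W :=
  bpMorph_comp (tens_inl _ _) (tens_inl (str_morph iota) (av_morph v)).
Definition T_tropBB : bpMorph (bpT Rr) W :=
  bpMorph_comp (tens_inl _ _) (tens_inr (str_morph iota) (av_morph v)).

Lemma BT_tropBB_bal b : B_tropBB (str_morph iota b) = T_tropBB (av_morph v b).
Proof.
exact: (congr1 (tens_inl (F1_init (trop v iota)) (F1_init BB)) (pure_bal _ _ b)).
Qed.

Definition bend_tropBB : {rmorphism bendGG v iota -> W} :=
  bend_univ tropBB_idem BT_tropBB_bal.

Lemma tropBB_pureE b t :
  B_tropBB (emb b) * T_tropBB (eT t) = tropBB_cls (trop_pure v b t) :> W.
Proof.
apply: etrans (esym (rmorphM (tens_inl (F1_init (trop v iota)) (F1_init BB)) _ _)) _.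
apply: (congr1 (tens_inl (F1_init (trop v iota)) (F1_init BB))).
by apply: etrans (pureM _ _ _ _ _ _) _; rewrite mulr1 mul1r.
Qed.

Lemma bend_tropBBU t a : bend_tropBB (bend_cls v iota (msrU t a)) =
  tropBB_cls (trop_pure v (Bterm iota 1 a) t).
Proof. exact: etrans (bend_univU _ _ _ _) (tropBB_pureE _ _). Qed.

Definition trop_bend : bpMorph (trop v iota) X := tens_univ (@bend_BT_bal _ _ v _ _ iota).
(** Compatibility over F1 is automatic: a semiring morphism sends the natural number [n] to [n]. *)
Lemma trop_bend_bal n :
  trop_bend (F1_init (trop v iota) n) = BB_morph (bend_idem v iota) (F1_init BB n).
Proof.
exact: etrans (rmorph_nat trop_bend n)
  (esym (rmorph_nat (BB_morph (bend_idem v iota)) n)).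
Qed.
Definition tropBB_bend : bpMorph W X := tens_univ trop_bend_bal.

Lemma tropBB_bendE c a t : tropBB_bend (tropBB_cls (trop_pure v (Bterm iota c a) t)) =
  bend_cls v iota (msrU (v c * t) a).
Proof.
apply: etrans (tens_univE trop_bend_bal _ _) _.
rewrite rmorph1 mulr1; apply: etrans (tens_univE (@bend_BT_bal _ _ v _ _ iota) _ _) _.
rewrite bend_BE bend_TE; apply: etrans (esym (rmorphM (bend_cls v iota) _ _)) _.
by rewrite msrUM mulg1.
Qed.

Lemma bend_tropBBK : cancel bend_tropBB tropBB_bend.
Proof.
apply: (@bend_ext _ _ v _ _ iota _ (tropBB_bend \o bend_tropBB) idfun) => t a.
rewrite [LHS](congr1 tropBB_bend (bend_tropBBU t a)).
by apply: etrans (tropBB_bendE 1 a t) _; rewrite av_one mul1r.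
Qed.

(** This is balancing over the base field, obtained from [bend_scalar] with [trop] as target and the
    two coprojections as [p] and [q]. *)
Lemma trop_pure_scalar c a t :
  trop_pure v (Bterm iota 1 a) (v c * t) = trop_pure v (Bterm iota c a) t.
Proof.
pose p := tens_inl (str_morph iota) (av_morph v).
pose q := tens_inr (str_morph iota) (av_morph v).
have pq b : p (str_morph iota b) = q (av_morph v b) by exact: pure_bal.
have pureE b s : trop_pure v b s = p (emb b) * q (eT s).
  by apply: esym; apply: etrans (pureM _ _ _ _ _ _) _; rewrite mulr1 mul1r.
rewrite !pureE (bend_scalar pq c a) -mulrA.
by congr (_ * _); exact: (@free_morph_embM (mulmon (tropR Rr))).
Qed.

Lemma tropBB_bendK : cancel tropBB_bend bend_tropBB.
Proof.
apply: (@rmorph_dot_ext W W (bend_tropBB \o tropBB_bend) idfun) => _ [y [b [ydot _ ->]]].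
(* Elements of [dot] in [tropBB] are tensors [y (x) b] with [b] in [BB]; for [b = 0] both sides
   vanish, leaving [b = 1]. *)
case: b => [|]; last by rewrite pure0r !rmorph0.
case: ydot => _ [_ [[x _ <-] [t _ <-] ->]].
have [[c a] ->] := Bdot_ex x.
(* The tensor of [iota(c a)] and [t] goes to the class of [(v(c) t) a], and returns with [v(c)] on
   the tropical side; balancing moves it back. *)
apply: etrans (congr1 bend_tropBB (tropBB_bendE c a t)) _.
by apply: etrans (bend_tropBBU _ _) _; rewrite trop_pure_scalar.
Qed.
End BendIso.

Theorem theorem2 (Rr : realType) (k : fieldType) (v : nonarch_absval k Rr)
    (A : comMonoidType) (hA : affine_toric A)
    (R : comPzRingType) (alg : {rmorphism k -> R})
    (iota : {rmorphism msr k A -> R})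
    (iota_alg : forall c : k, iota (msrU c 1%g) = alg c)
    (iota_surj : forall x : R, exists p : msr k A, iota p = x) :
  exists f : {rmorphism bendGG v iota -> tropBB v iota},
    [/\ bijective f,
        forall (t : tropR Rr) (a : A),
          f (bend_cls v iota (msrU t a)) =
            tropBB_cls (trop_pure v (Bterm iota 1 a) t)
      & forall g : {rmorphism bendGG v iota -> tropBB v iota},
          (forall (t : tropR Rr) (a : A),
             g (bend_cls v iota (msrU t a)) =
               tropBB_cls (trop_pure v (Bterm iota 1 a) t)) ->
          g =1 f].
Proof.
exists (bend_tropBB v iota); split=> [|t a|g gE].
- by exists (tropBB_bend v iota); [exact: bend_tropBBK|exact: tropBB_bendK].
- exact: bend_tropBBU.
- by apply: bend_ext => t a; rewrite gE bend_tropBBU.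
Qed.
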